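(* For every positive integer $n$ there exists a non-trivial two-coloring $C$ of $\mathbb{Z}^d$ with $d = 2n^2 - n$ and $r(C) = n$; in particular $d = 2r(C)^2 - r(C)$.
   Context: A two-coloring $C$ of $\mathbb{Z}^d$ assigns to each lattice point one of two colors, red or blue. $C$ is non-trivial if the origin is red and, for each $i \in \{1,\dots,d\}$, there is at least one blue point on the $i$-th coordinate axis (a point all of whose coordinates other than the $i$-th are zero). For $x \in \mathbb{Z}^d$, the axis-sensitivity $r(C,x)$ is the number of indices $i \in \{1,\dots,d\}$ such that at least one of $x+e_i$, $x-e_i$ has a color different from that of $x$ ($e_i$ the $i$-th standard unit vector). The axis-sensitivity of $C$ is $r(C)=\max_{x\in\mathbb{Z}^d} r(C,x)$. *)

(* Defs.v *)
From mathcomp Require Import all_boot all_order all_algebra.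
From mathcomp Require Import boolp.
Set Implicit Arguments.
Unset Strict Implicit.
Unset Printing Implicit Defensive.
Import GRing.Theory.
Local Open Scope ring_scope.

Definition color : Type := bool.
Definition red : color := true.
Definition blue : color := false.

Definition coloring (d : nat) : Type := 'rV[int]_d -> color.

Definition unit_vec (d : nat) (i : 'I_d) : 'rV[int]_d := delta_mx 0 i.

Definition on_axis (d : nat) (i : 'I_d) (x : 'rV[int]_d) : Prop :=
  forall j : 'I_d, j != i -> x 0 j = 0.

Definition nontrivial (d : nat) (C : coloring d) : Prop :=
  C 0 = red /\
  forall i : 'I_d, exists x : 'rV[int]_d, on_axis i x /\ C x = blue.

Definition axis_sensitivity_at (d : nat) (C : coloring d) (x : 'rV[int]_d) : nat :=
  #|[set i : 'I_d | (C (x + unit_vec i) != C x) || (C (x - unit_vec i) != C x)]|.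

(* Every value of axis_sensitivity_at C is at most d, so the maximum over the
   infinite set Z^d is the largest k <= d that is attained. *)
Definition axis_sensitivity (d : nat) (C : coloring d) : nat :=
  (\max_(k < d.+1 | `[< exists x : 'rV[int]_d, axis_sensitivity_at C x = k >]) k)%N.

Lemma axis_sensitivity_at_le_dim (d : nat) (C : coloring d) (x : 'rV[int]_d) :
  (axis_sensitivity_at C x <= d)%N.
Proof. by rewrite -[leqRHS]card_ord max_card. Qed.

Lemma axis_sensitivity_ge (d : nat) (C : coloring d) (x : 'rV[int]_d) :
  (axis_sensitivity_at C x <= axis_sensitivity C)%N.
Proof.
have lt_d : (axis_sensitivity_at C x < d.+1)%N.
  by rewrite ltnS axis_sensitivity_at_le_dim.
apply: (leq_bigmax_cond (F := fun k : 'I_d.+1 => k : nat) (Ordinal lt_d)).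
by apply/asboolP; exists x.
Qed.

Lemma axis_sensitivity_attained (d : nat) (C : coloring d) :
  exists x : 'rV[int]_d, axis_sensitivity_at C x = axis_sensitivity C.
Proof.
have lt_d : (axis_sensitivity_at C 0 < d.+1)%N.
  by rewrite ltnS axis_sensitivity_at_le_dim.
rewrite /axis_sensitivity (bigmax_eq_arg (Ordinal lt_d)); last first.
  by apply/asboolP; exists 0.
case: arg_maxnP => [|k /asboolP[x xk] _]; first by apply/asboolP; exists 0.
by exists x.
Qed.

(* Main.v *)
Require Import Defs.
From mathcomp Require Import all_boot.
From mathcomp Require Import all_order all_algebra zify.

(** Split the [n (2n - 1)] axes into [n] groups of [2n - 1] and put a regular
    tournament on each group.  For each axis [a], paint blue the region
    [x_a >= 2], [x_j <= 0] for the [n - 1] out-neighbours [j] of [a]; the rest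
    is red.  A region constrains only [n] coordinates, so a blue point is
    sensitive along at most [n] axes, and the point [2 e_a] is sensitive along
    [n] of them.  For an arc from [a] to [b], the region of [a] has [x_b <= 0]
    and that of [b] has [x_b >= 2], so two regions of the same group cannot be
    entered from one red point along two different axes: a red point is
    sensitive along at most one axis per group. *)

Set Implicit Arguments.
Unset Strict Implicit.
Unset Printing Implicit Defensive.
Import Order.TTheory GRing.Theory Num.Theory.

Lemma leq_card_rel_inj (T U : finType) (A : {pred T}) (r : T -> U -> bool) :
  (forall x, x \in A -> exists u, r x u) ->
  (forall x y u, x \in A -> y \in A -> r x u -> r y u -> x = y) ->
  #|A| <= #|U|.
Proof.
move=> r_total r_inj; rewrite -(card_image Some_inj A).
apply: leq_trans (leq_image_card (fun u => [pick x in A | r x u]) U).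
apply/subset_leq_card/subsetP => _ /imageP[x Ax ->].
have [u rxu] := r_total x Ax; apply/imageP; exists u => //.
by case: pickP => [y /andP[Ay ryu]|/(_ x)]; rewrite ?Ax ?rxu // (r_inj x y u).
Qed.

Lemma card_preim_bij (T U : finType) (f : T -> U) (A : {pred U}) :
  bijective f -> #|[preim f of A]| = #|A|.
Proof.
case=> g fK gK; rewrite (card_preim (can_inj fK)).
by apply: eq_card => u; rewrite inE -[u in u \in codom f]gK codom_f.
Qed.

Lemma card_relpre (T U : finType) (f : T -> U) (e : rel U) (a : T) :
  bijective f -> #|relpre f e a| = #|e (f a)|.
Proof. exact: card_preim_bij. Qed.

Definition total_within (T cT : Type) (cls : T -> cT) (e : rel T) : Prop :=
  forall a b, cls a = cls b -> e a b || e b a.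

Lemma total_within_refl (T cT : Type) (cls : T -> cT) (e : rel T) :
  total_within cls e -> reflexive e.
Proof. by move=> e_total a; have := e_total a a erefl; rewrite orbb. Qed.

Lemma total_within_relpre (S T cT : Type) (f : S -> T) (cls : T -> cT) (e : rel T) :
  total_within cls e -> total_within (cls \o f) (relpre f e).
Proof. by move=> e_total a b; apply: e_total. Qed.

Section DisjointCopies.

Variables (I V : finType) (e : rel V).

Definition disjoint_copies : rel (I * V) :=
  fun u v => (u.1 == v.1) && e u.2 v.2.

Lemma disjoint_copies_total_within : total e -> total_within fst disjoint_copies.
Proof.
by move=> e_total u v uv; rewrite /disjoint_copies uv eqxx; apply: e_total.
Qed.

Lemma card_disjoint_copies (u : I * V) : #|disjoint_copies u| = #|e u.2|.
Proof.
rewrite -[RHS]mul1n -(card1 u.1) -cardX; apply: eq_card => v.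
by rewrite !inE [v \in _ u]unfold_in eq_sym.
Qed.

End DisjointCopies.

(* [b - a] is the least nonnegative residue modulo [2p + 1]. *)
Definition rotational_tournament (p : nat) : rel 'I_p.*2.+1 :=
  fun a b => (b - a)%R <= p.

Lemma rotational_tournament_total (p : nat) : total (@rotational_tournament p).
Proof.
move=> a b; rewrite /rotational_tournament -(opprB b a); move: (b - a)%R => c.
have [//|lt_pc] := leqP c p.
by rewrite /= modn_small; have := ltn_ord c; lia.
Qed.

Lemma card_rotational_tournament (p : nat) (a : 'I_p.*2.+1) :
  #|rotational_tournament a| = p.+1.
Proof.
have sub_bij : bijective (fun b => b - a)%R.
  by exists (fun c => c + a)%R => b; rewrite (subrK, addrK).
rewrite [LHS](card_preim_bij [pred c : 'I__ | c < p.+1] sub_bij) -sum1_card.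
by rewrite -(big_ord_widen _ (fun=> 1)) ?sum1_card ?card_ord //; lia.
Qed.

Section Neighbors.

Local Open Scope ring_scope.

Variable d : nat.
Implicit Types (x y z : 'rV[int]_d) (i j k : 'I_d) (C : coloring d).

Definition neighbors i x : seq 'rV[int]_d := [:: x + unit_vec i; x - unit_vec i].

Lemma axis_sensitivity_atE C x :
  axis_sensitivity_at C x = #|[pred i | has (fun y => C y != C x) (neighbors i x)]|.
Proof. by rewrite -cardsE; apply: eq_card => i; rewrite !inE /= orbF. Qed.

Lemma neighbors_normB i x y k :
  y \in neighbors i x -> `|y 0 k - x 0 k| = (k == i)%:R.
Proof.
by rewrite !inE => /orP[]/eqP->; rewrite !mxE eqxx addrC addrK ?normrN normr_nat.
Qed.

Lemma neighbors_eq_off_axis i x y k :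
  y \in neighbors i x -> k != i -> y 0 k = x 0 k.
Proof.
move=> /(neighbors_normB k) + /negbTE ki; rewrite ki => /eqP.
by rewrite normr_eq0 subr_eq0 => /eqP.
Qed.

Lemma neighbors_coord_eq i j x y z k :
  i != j -> y \in neighbors i x -> z \in neighbors j x ->
  x 0 k = y 0 k \/ x 0 k = z 0 k.
Proof.
move=> ij xy xz; have [->|ki] := eqVneq k i.
  by right; rewrite (neighbors_eq_off_axis xz).
by left; rewrite (neighbors_eq_off_axis xy).
Qed.

Lemma neighbors_dist_le1 i j x y z k :
  i != j -> y \in neighbors i x -> z \in neighbors j x ->
  `|y 0 k - z 0 k| <= 1.
Proof.
move=> ij xy xz; have [<-|<-] := neighbors_coord_eq k ij xy xz.
  by rewrite distrC (neighbors_normB _ xz) lern1 leq_b1.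
by rewrite (neighbors_normB _ xy) lern1 leq_b1.
Qed.

End Neighbors.

Section DigraphColoring.

Local Open Scope ring_scope.

Variables (d : nat) (e : rel 'I_d).
Implicit Types (x y z : 'rV[int]_d) (a b i j : 'I_d).

(* The loop of [e] at [a] accounts for the constraint on the coordinate [a] itself,
   so that the region of [a] constrains exactly the out-neighbours of [a]. *)
Definition blue_region a x : bool :=
  [forall (j | e a j), if j == a then 2 <= x 0 j else x 0 j <= 0].

Definition digraph_coloring : coloring d :=
  fun x => if [exists a, blue_region a x] then blue else red.

Lemma digraph_coloring_blueP x :
  reflect (exists a, blue_region a x) (digraph_coloring x == blue).
Proof. by rewrite /digraph_coloring; case: existsP => ?; constructor. Qed.

Lemma digraph_coloring_neq_red x :
  (digraph_coloring x != red) = (digraph_coloring x == blue).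
Proof. by case: (digraph_coloring x). Qed.

Lemma blue_region_coordwise a x y z :
  (forall k, x 0 k = y 0 k \/ x 0 k = z 0 k) ->
  blue_region a y -> blue_region a z -> blue_region a x.
Proof.
move=> xyz /forall_inP ya /forall_inP za; apply/forall_inP => j aj.
by have [->|->] := xyz j; [apply: ya | apply: za].
Qed.

Lemma blue_region_neighbors a i x y :
  ~~ e a i -> y \in neighbors i x -> blue_region a y = blue_region a x.
Proof.
move=> Nai xy; apply: eq_forallb_in => j aj.
by rewrite (neighbors_eq_off_axis xy) //; apply: contraNneq Nai => <-.
Qed.

Lemma digraph_coloring_blue_sensitivity a x :
  blue_region a x -> (axis_sensitivity_at digraph_coloring x <= #|e a|)%N.
Proof.
move=> xa; rewrite axis_sensitivity_atE.
have blue_of y : blue_region a y -> digraph_coloring y = blue.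
  by move=> ya; apply/eqP/digraph_coloring_blueP; exists a.
apply/subset_leq_card/subsetP => i /hasP[y xy].
by apply: contraR => Nai; rewrite !blue_of // (blue_region_neighbors Nai xy).
Qed.

Hypothesis e_refl : reflexive e.

Lemma blue_region_ge2 a x : blue_region a x -> 2 <= x 0 a.
Proof. by move=> /forall_inP/(_ a (e_refl a)); rewrite eqxx. Qed.

Lemma blue_region_gap a b x y :
  a != b -> e a b -> blue_region a x -> blue_region b y -> 2 <= y 0 b - x 0 b.
Proof.
move=> ab eab /forall_inP/(_ b eab) xa /blue_region_ge2 yb.
by move: xa; rewrite eq_sym (negbTE ab); lia.
Qed.

Lemma digraph_coloring_blueE a x :
  (forall k, k != a -> x 0 k < 2) ->
  (digraph_coloring x == blue) = blue_region a x.
Proof.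
move=> x_lt2; apply/digraph_coloring_blueP/idP => [[b xb]|]; last by exists a.
by have [<-|/x_lt2] := eqVneq b a; rewrite // ltNge blue_region_ge2.
Qed.

Definition axis_point a : 'rV[int]_d := 2 *: unit_vec a.

Lemma blue_region_axis_point a : blue_region a (axis_point a).
Proof.
apply/forall_inP => j _; rewrite !mxE eqxx /=.
by case: (j == a); rewrite ?mulr1 ?mulr0.
Qed.

Lemma digraph_coloring_axis_point a : digraph_coloring (axis_point a) = blue.
Proof.
apply/eqP/digraph_coloring_blueP; exists a.
exact: blue_region_axis_point.
Qed.

Lemma digraph_coloring_nontrivial : nontrivial digraph_coloring.
Proof.
split=> [|a].
  apply/eqP; rewrite -[_ == _]negbK digraph_coloring_neq_red.
  by apply/digraph_coloring_blueP => -[a /blue_region_ge2]; rewrite mxE.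
exists (axis_point a); split; last exact: digraph_coloring_axis_point.
by move=> j /negbTE ja; rewrite !mxE ja mulr0.
Qed.

Lemma outdegree_le_axis_sensitivity a :
  (#|e a| <= axis_sensitivity digraph_coloring)%N.
Proof.
apply: leq_trans (axis_sensitivity_ge _ (axis_point a)).
rewrite axis_sensitivity_atE digraph_coloring_axis_point.
apply/subset_leq_card/subsetP => j aj; apply/hasP.
have [->|Nja] := eqVneq j a.
  exists (axis_point a - unit_vec a); first by rewrite !inE eqxx orbT.
  rewrite (digraph_coloring_blueE (a := a)).
    by apply/negP => /blue_region_ge2; rewrite !mxE !eqxx.
  by move=> k /negbTE ka; rewrite !mxE ka.
exists (axis_point a + unit_vec j); first by rewrite !inE eqxx.
rewrite (digraph_coloring_blueE (a := a)).
  apply/negP => /forall_inP/(_ j aj).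
  by rewrite !mxE (negbTE Nja) !eqxx.
by move=> k /negbTE ka; rewrite !mxE ka /=; case: (k == j).
Qed.

End DigraphColoring.

Section SensitivityBound.

Local Open Scope ring_scope.

Variables (d : nat) (e : rel 'I_d) (cT : finType) (cls : 'I_d -> cT).
Hypothesis e_total : total_within cls e.

Lemma blue_between_regions (a b i j : 'I_d) (x y z : 'rV[int]_d) :
  i != j -> y \in neighbors i x -> z \in neighbors j x -> cls a = cls b ->
  blue_region e a y -> blue_region e b z -> digraph_coloring e x = blue.
Proof.
move=> ij xy xz ab ya zb; have e_refl := total_within_refl e_total.
have [eq_ab|Nab] := eqVneq a b.
  apply/eqP/digraph_coloring_blueP; exists a; rewrite -eq_ab in zb.
  exact: blue_region_coordwise (fun k => neighbors_coord_eq k ij xy xz) ya zb.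
have yz := neighbors_dist_le1 _ ij xy xz.
have [eab|eba] := orP (e_total ab).
  by have := blue_region_gap e_refl Nab eab ya zb; have := yz b; lia.
rewrite eq_sym in Nab.
by have := blue_region_gap e_refl Nab eba zb ya; have := yz a; lia.
Qed.

Lemma digraph_coloring_red_sensitivity (x : 'rV[int]_d) :
  digraph_coloring e x = red ->
  (axis_sensitivity_at (digraph_coloring e) x <= #|cT|)%N.
Proof.
move=> redx; rewrite axis_sensitivity_atE redx.
pose enters i c := has (fun y => [exists a, (cls a == c) && blue_region e a y])
                       (neighbors i x).
apply: (leq_card_rel_inj (r := enters)) => [i /hasP[y xy]|i j c _ _].
  rewrite digraph_coloring_neq_red => /digraph_coloring_blueP[a ya].
  by exists (cls a); apply/hasP; exists y => //; apply/existsP; exists a; rewrite eqxx.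
move=> /hasP[y xy /existsP[a /andP[/eqP ac ya]]].
move=> /hasP[z xz /existsP[b /andP[/eqP bc zb]]].
apply: contra_eq redx => ij.
by rewrite (blue_between_regions ij xy xz _ ya zb) ?ac.
Qed.

Lemma digraph_coloring_sensitivity_le (n : nat) :
  (forall a, #|e a| <= n)%N -> (#|cT| <= n)%N ->
  (axis_sensitivity (digraph_coloring e) <= n)%N.
Proof.
move=> outdeg_le cT_le.
have [x <-] := axis_sensitivity_attained (digraph_coloring e).
have [/digraph_coloring_blueP[a xa]|Nblue] := boolP (digraph_coloring e x == blue).
  exact: leq_trans (digraph_coloring_blue_sensitivity xa) (outdeg_le a).
apply: leq_trans cT_le; apply: digraph_coloring_red_sensitivity.
by move: Nblue; case: (digraph_coloring e x).
Qed.

Lemma digraph_coloring_sensitivity_regular (n : nat) :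
  (0 < d)%N -> (forall a, #|e a| = n) -> (#|cT| <= n)%N ->
  axis_sensitivity (digraph_coloring e) = n.
Proof.
move=> d_gt0 outdegE cT_le; apply/eqP; rewrite eqn_leq; apply/andP; split.
  by apply: digraph_coloring_sensitivity_le => // a; rewrite outdegE.
rewrite -(outdegE (Ordinal d_gt0)).
exact: outdegree_le_axis_sensitivity (total_within_refl e_total) _.
Qed.

End SensitivityBound.

Theorem theorem3 (n : nat) (hn : 0 < n) :
  exists (d : nat) (C : coloring d),
    [/\ d = 2 * n ^ 2 - n,
        nontrivial C,
        axis_sensitivity C = n
      & d = 2 * axis_sensitivity C ^ 2 - axis_sensitivity C].
Proof.
case: n hn => // p _.
pose T : finType := ('I_p.+1 * 'I_p.*2.+1)%type.
pose e : rel 'I_#|T| :=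
  relpre enum_val (disjoint_copies (@rotational_tournament p)).
have dE : #|T| = 2 * p.+1 ^ 2 - p.+1 by rewrite card_prod !card_ord; nia.
have e_total : total_within (fst \o enum_val) e.
  apply/total_within_relpre/disjoint_copies_total_within.
  exact: rotational_tournament_total.
have outdegE a : #|e a| = p.+1.
  rewrite (card_relpre _ _ (@enum_val_bij T)).
  by rewrite card_disjoint_copies card_rotational_tournament.
have sensE : axis_sensitivity (digraph_coloring e) = p.+1.
  apply: (digraph_coloring_sensitivity_regular e_total) => //.
    by rewrite card_prod !card_ord.
  by rewrite card_ord.
exists #|T|, (digraph_coloring e); split=> //; last by rewrite sensE.
exact: digraph_coloring_nontrivial (total_within_refl e_total).
Qed.
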